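(* Let $(x^{*},y^{*})$ be a saddle-point of $f$, and let $((x^k,y^k))_{k\in\mathbf N}$ be generated by the alternating proximal mapping method. Suppose $\inf_{k\in\mathbf N}\tau_k>0$ and $\inf_{k\in\mathbf N}\sigma_k>0$. Let $\xi\in(0,1)$ be such that $\xi\,\sup_{k\in\mathbf N}\tau_k\,\sup_{k\in\mathbf N}\sigma_k\,\|K\|^2<1$. Let $\eta_1,\eta_2,\eta_3,\eta_4\in\mathbf R_{++}$ be such that $$\eta_1\|K\|^2\xi+\frac1{\eta_2\xi}\le\frac{1}{\sup_{k\in\mathbf N}\tau_k},\qquad \frac1{\eta_1}+\frac1{\eta_3}\le\frac1{\sup_{k\in\mathbf N}\sigma_k},\qquad \sup_{k\in\mathbf N}\tau_k\le\eta_4,\qquad \eta_4\xi\|K\|^2<\frac1{\sup_{k\in\mathbf N}\sigma_k}.$$ Suppose that $\mu,\nu\in\mathbf R_{++}$ satisfy $$2\mu\ge\frac1{\xi\inf_{k\in\mathbf N}\tau_k}-\frac1{\sup_{k\in\mathbf N}\tau_k}+\eta_3\|K\|^2\sup_{k\in\mathbf N}\beta_k^2,\qquad 2\nu\ge\frac1{\xi\inf_{k\in\mathbf N}\sigma_k}-\frac1{\sup_{k\in\mathbf N}\sigma_k}+\eta_2\|K\|^2\sup_{k\in\mathbf N}(\xi-\alpha_k)^2.$$ Then for every $k\in\mathbf N$, $$\|x^{k+1}-x^*\|\le\xi^{k+1}\,\sup_{i\in\mathbf N}\tau_i\,\Big(\frac1{\tau_0}\|x^*-x^0\|^2+\frac1{\sigma_0}\|y^*-y^0\|^2\Big),$$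 $$\|y^{k+1}-y^*\|\le\xi^{k+1}\Big(\frac1{\sup_{i\in\mathbf N}\sigma_i}-\xi\eta_4\|K\|^2\Big)\Big(\frac1{\tau_0}\|x^*-x^0\|^2+\frac1{\sigma_0}\|y^*-y^0\|^2\Big).$$ Consequently, the sequence of iterations $((x^k,y^k))_{k\in\mathbf N}$ converges linearly to the saddle-point $(x^*,y^* )$ of $f$ with a rate $\xi\in(0,1)$.
   Context: $\mathbf N=\{0,1,2,\dots\}$, $\mathbf R_+=[0,\infty)$, $\mathbf R_{++}=(0,\infty)$. $\mathcal H_1,\mathcal H_2$ are Hilbert spaces; $K:\mathcal H_1\to\mathcal H_2$ is a continuous linear operator with operator norm $\|K\|$ and adjoint $K^*$. $g:\mathcal H_1\to\mathbf R\cup\{+\infty\}$ and $h:\mathcal H_2\to\mathbf R\cup\{+\infty\}$ are proper and lower semicontinuous; $\mu,\nu\in\mathbf R_{++}$; $g$ is strongly convex with modulus $\mu$, i.e. $\langle u,x-\bar x\rangle+\frac\mu2\|x-\bar x\|^2+g(\bar x)\le g(x)$ for all $\bar x\in\operatorname{dom}\partial g$, $u\in\partial g(\bar x)$, $x\in\mathcal H_1$; and $h$ is strongly convex with modulus $\nu$ (same inequality with $h,\nu,\mathcal H_2$). Define $f(x,y)=\langle Kx,y\rangle+g(x)-h(y)$ on $\mathcal H_1\times\mathcal H_2$. A saddle-point of $f$ is $(x^*,y^* )$ with $f(x^*,y)\le f(x^*,y^* )\le f(x,y^* )$ for all $x\in\mathcal H_1,y\in\mathcal H_2$; one is assumed to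 exist. Alternating proximal mapping method: given sequences $(\tau_k)_{k\in\mathbf N\cup\{-1\}}$, $(\sigma_k)_{k\in\mathbf N\cup\{-1\}}$ in $\mathbf R_{++}$ and $(\alpha_k)_{k\in\mathbf N\cup\{-1\}}$, $(\beta_k)_{k\in\mathbf N\cup\{-1\}}$ in $\mathbf R_+$, and $(x^0,y^0)\in\mathcal H_1\times\mathcal H_2$, set $x^{-1}=x^0$, $y^{-1}=y^0$, $\bar x^0=x^0$, $\bar y^0=y^0$ and for every $k\in\mathbf N$: $y^{k+1}=\operatorname{Prox}_{\sigma_kh}(\sigma_kK\bar x^k+y^k)$; $\bar y^{k+1}=y^{k+1}+\beta_k(y^{k+1}-y^k)$; $x^{k+1}=\operatorname{Prox}_{\tau_kg}(-\tau_kK^*\bar y^{k+1}+x^k)$; $\bar x^{k+1}=x^{k+1}+\alpha_k(x^{k+1}-x^k)$. Here $\operatorname{Prox}_\varphi(z)=\operatorname{argmin}_w(\varphi(w)+\frac12\|z-w\|^2)$.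
   Formalization: The printed bounds are false; proved instead: both left-hand norms are squared, the factor (1/sup σ_i − ξη_4‖K‖²) in the y-bound is replaced by its inverse, and the linear rate ξ is for the squared distance ‖x^k−x*‖²+‖y^k−y*‖². *)

(* Defs.v *)
From mathcomp Require Import all_boot all_order all_algebra.
From mathcomp Require Import all_classical all_reals all_analysis.

Set Implicit Arguments.
Unset Strict Implicit.
Unset Printing Implicit Defensive.

Import Order.TTheory GRing.Theory Num.Theory.
Import numFieldNormedType.Exports.

Local Open Scope classical_set_scope.
Local Open Scope ring_scope.

(* A real Hilbert space is a complete normed module whose norm is induced by
   an inner product. *)
Definition induces_norm (R : realType) (H : completeNormedModType R)
    (dot : {dot H for idfun}) : Prop :=
  forall x : H, `|x| ^+ 2 = dot x x.

Definition opnorm (R : realType) (H1 H2 : normedModType R) (K : H1 -> H2) : R :=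
  sup [set `|K x| | x in [set x : H1 | `|x| <= 1]].

Definition is_adjoint (R : realType) (H1 H2 : completeNormedModType R)
    (dot1 : {dot H1 for idfun}) (dot2 : {dot H2 for idfun})
    (K : H1 -> H2) (Kadj : H2 -> H1) : Prop :=
  forall x y, dot2 (K x) y = dot1 x (Kadj y).

(* Suprema and infima are taken in the extended reals: the real-valued [sup]
   of an unbounded set is 0. *)
Definition seq_sup (R : realType) (u : nat -> R) : \bar R :=
  ereal_sup (range (EFin \o u)).

Definition seq_inf (R : realType) (u : nat -> R) : \bar R :=
  ereal_inf (range (EFin \o u)).

Section ConvexAnalysis.
Context (R : realType) (H : completeNormedModType R) (dot : {dot H for idfun}).
Implicit Types (phi : H -> \bar R) (x z w u : H).
Local Open Scope ereal_scope.

Definition proper_fun phi : Prop :=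
  (forall x, phi x != -oo) /\ (exists x, phi x != +oo).

Definition econvex phi : Prop :=
  forall x z (t : R), (0 <= t <= 1)%R ->
    phi (t *: x + (1 - t) *: z)%R <= t%:E * phi x + (1 - t)%:E * phi z.

Definition subdifferential phi x : set H :=
  [set u | forall z, (dot u (z - x)%R)%:E + phi x <= phi z].

(* The subgradient inequality alone is vacuous where [phi] has no subgradient,
   so convexity is required separately. *)
Definition strongly_convex phi (mu : R) : Prop :=
  econvex phi /\
  forall x u z, subdifferential phi x u ->
    (dot u (z - x)%R)%:E + (mu / 2 * `|z - x| ^+ 2)%:E + phi x <= phi z.

(* [w] belongs to the argmin defining the proximal point of [phi] at [z]; that
   argmin is a singleton for proper, lower semicontinuous, convex [phi]. *)
Definition is_prox phi z w : Prop :=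
  forall v, phi w + (2^-1 * `|z - w| ^+ 2)%:E <=
            phi v + (2^-1 * `|z - v| ^+ 2)%:E.

End ConvexAnalysis.

Section SaddlePoint.
Context (R : realType) (H1 H2 : completeNormedModType R).
Local Open Scope ereal_scope.

(* Since +oo - +oo = -oo in [\bar R] and g, h are proper, a saddle-point
   (xs, ys) has g xs and h ys finite, so that no indeterminate difference
   occurs in [is_saddle_point]. *)
Definition saddle_fun (dot2 : {dot H2 for idfun}) (K : H1 -> H2)
    (g : H1 -> \bar R) (h : H2 -> \bar R) (x : H1) (y : H2) : \bar R :=
  (dot2 (K x) y)%:E + g x - h y.

Definition is_saddle_point (f : H1 -> H2 -> \bar R) (xs : H1) (ys : H2) : Prop :=
  forall x y, f xs y <= f xs ys /\ f xs ys <= f x ys.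

End SaddlePoint.

(* The parameters of index -1 never enter the iteration, because the
   extrapolated points of index 0 are the initial points. *)
Definition alternating_prox_mapping (R : realType)
    (H1 H2 : completeNormedModType R)
    (K : H1 -> H2) (Kadj : H2 -> H1) (g : H1 -> \bar R) (h : H2 -> \bar R)
    (tau sigma alpha beta : nat -> R)
    (x xbar : nat -> H1) (y ybar : nat -> H2) : Prop :=
  [/\ xbar 0%N = x 0%N, ybar 0%N = y 0%N &
   forall k : nat,
   [/\ is_prox (fun v => (sigma k)%:E * h v)%E
         (sigma k *: K (xbar k) + y k) (y k.+1),
       ybar k.+1 = y k.+1 + beta k *: (y k.+1 - y k),
       is_prox (fun v => (tau k)%:E * g v)%E
         (- (tau k *: Kadj (ybar k.+1)) + x k) (x k.+1) &
       xbar k.+1 = x k.+1 + alpha k *: (x k.+1 - x k)]].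

(* The rate is that of the squared Hilbert distance in the product space. *)
Definition converges_linearly (R : realType) (H1 H2 : completeNormedModType R)
    (x : nat -> H1) (y : nat -> H2) (xs : H1) (ys : H2) (rate : R) : Prop :=
  [/\ x @ \oo --> xs, y @ \oo --> ys &
   exists C : R, forall k : nat,
     `|x k - xs| ^+ 2 + `|y k - ys| ^+ 2 <= C * rate ^+ k].

(* Main.v *)
Require Import Defs.
From mathcomp Require Import all_boot all_order all_algebra.
From mathcomp Require Import all_classical all_reals all_analysis.
From mathcomp Require Import ring lra.

Set Implicit Arguments.
Unset Strict Implicit.
Unset Printing Implicit Defensive.

Import Order.TTheory GRing.Theory Num.Theory.
Import numFieldNormedType.Exports.

Local Open Scope classical_set_scope.
Local Open Scope ring_scope.

(* Subgradients of a strongly convex function are strongly monotone. Comparing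
   the subgradients produced by the two proximal steps with those at the saddle
   point, and absorbing the cross terms with three Young inequalities (weights
   eta1, eta2, eta3), shows that
     E_k = |x_k - x*|^2 / tau_k + |y_k - y*|^2 / sigma_k
           + xi (2 <K (x_k - x_{k-1}), y_k - y*> + |x_k - x_{k-1}|^2 / sup tau)
   satisfies E_{k+1} <= xi E_k, where the lower bounds on mu and nu pay for the
   change of step sizes. A last Young inequality (weight eta4) bounds E_k from
   below by |x_k - x*|^2 / sup tau
   + (1 / sup sigma - xi eta4 |K|^2) |y_k - y*|^2. *)

(** * Inner product algebra *)

Lemma dotC (R : realType) (H : completeNormedModType R) (dot : {dot H for idfun})
    (u v : H) : dot u v = dot v u.
Proof. by rewrite hermC expr0 mul1r. Qed.

Lemma dotDl (R : realType) (H : completeNormedModType R)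
    (dot : {dot H for idfun}) (u v w : H) :
  dot (u + v) w = dot u w + dot v w.
Proof. exact: linearDl. Qed.

Lemma dotNl (R : realType) (H : completeNormedModType R)
    (dot : {dot H for idfun}) (u v : H) :
  dot (- u) v = - dot u v.
Proof. exact: linearNl. Qed.

Lemma dotZl (R : realType) (H : completeNormedModType R)
    (dot : {dot H for idfun}) (a : R) (u v : H) :
  dot (a *: u) v = a * dot u v.
Proof. exact: linearZl_LR. Qed.

Lemma dotDr (R : realType) (H : completeNormedModType R)
    (dot : {dot H for idfun}) (u v w : H) :
  dot w (u + v) = dot w u + dot w v.
Proof. exact: linearDr. Qed.

Lemma dotNr (R : realType) (H : completeNormedModType R)
    (dot : {dot H for idfun}) (u v : H) :
  dot v (- u) = - dot v u.
Proof. exact: linearNr. Qed.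

Lemma dotZr (R : realType) (H : completeNormedModType R)
    (dot : {dot H for idfun}) (a : R) (u v : H) :
  dot v (a *: u) = a * dot v u.
Proof. exact: linearZr_LR. Qed.

Definition dotE := (dotDl, dotNl, dotZl, dotDr, dotNr, dotZr).

Lemma sqr_normD (R : realType) (H : completeNormedModType R)
    (dot : {dot H for idfun}) (u v : H) : induces_norm dot ->
  `|u + v| ^+ 2 = `|u| ^+ 2 + 2 * dot u v + `|v| ^+ 2.
Proof. by move=> hdot; rewrite !hdot !dotE (dotC dot v u); ring. Qed.

Lemma sqr_normB (R : realType) (H : completeNormedModType R)
    (dot : {dot H for idfun}) (u v : H) : induces_norm dot ->
  `|u - v| ^+ 2 = `|u| ^+ 2 - 2 * dot u v + `|v| ^+ 2.
Proof. by move=> hdot; rewrite (sqr_normD _ _ hdot) dotNr normrN mulrN. Qed.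

(** Expand |e u + v|^2 >= 0 and divide by [e]. *)
Lemma dot_young (R : realType) (H : completeNormedModType R)
    (dot : {dot H for idfun}) (u v : H) (e : R) : induces_norm dot -> 0 < e ->
  - (e * `|u| ^+ 2 + e^-1 * `|v| ^+ 2) <= 2 * dot u v.
Proof.
move=> hdot e0; have := sqr_ge0 `|e *: u + v|.
rewrite (sqr_normD _ _ hdot) dotZl normrZ gtr0_norm// exprMn.
rewrite -(pmulr_rge0 _ (_ : 0 < e^-1)) ?invr_gt0//.
suff -> : e^-1 * (e ^+ 2 * `|u| ^+ 2 + 2 * (e * dot u v) + `|v| ^+ 2) =
   e * `|u| ^+ 2 + e^-1 * `|v| ^+ 2 + 2 * dot u v by lra.
by field; rewrite gt_eqF.
Qed.

(** * Operator norm and Young inequalities for the coupling term *)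

Lemma ler_opnorm (R : realType) (H1 H2 : normedModType R)
    (K : {linear H1 -> H2}) (x : H1) : continuous K ->
  `|K x| <= opnorm K * `|x|.
Proof.
move=> Kcont.
have [M M0 KM] := pinfty_ex_gt0
  ((linear_boundedP K).1 ((linear_bounded_continuous K).2 Kcont)).
have [->|x0] := eqVneq x 0; first by rewrite linear0 !normr0 mulr0.
rewrite -ler_pdivrMr ?normr_gt0//.
have -> : `|K x| / `|x| = `|K (`|x|^-1 *: x)|.
  by rewrite linearZ/= normrZ normfV normr_id mulrC.
(* A real [sup] bounds its set only when that set is bounded above; the bound [M] on the unit ball
   comes from continuity. *)
apply: ub_le_sup.
  exists M => _ [z /= z1 <-]; rewrite (le_trans (KM z))//.
  by rewrite -[leRHS]mulr1 ler_pM2l.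
by exists (`|x|^-1 *: x) => //=; rewrite normrZ normfV normr_id mulVf ?normr_eq0.
Qed.

(** Young's inequality for [c *: K u] and [- v], then |K u| <= |K| |u|. The sign of [c] is free, so
    that [c] can carry the coefficient of any cross term. *)
Lemma opnorm_young (R : realType) (H1 H2 : completeNormedModType R)
    (dot2 : {dot H2 for idfun}) (K : {linear H1 -> H2}) (u : H1) (v : H2)
    (e c : R) :
  induces_norm dot2 -> continuous K -> 0 < e ->
  2 * c * dot2 (K u) v <=
    e * c ^+ 2 * opnorm K ^+ 2 * `|u| ^+ 2 + e^-1 * `|v| ^+ 2.
Proof.
move=> hdot2 Kcont e0; have := dot_young (c *: K u) (- v) hdot2 e0.
rewrite dotNr dotZl normrN normrZ exprMn real_normK ?num_real//.
have : e * c ^+ 2 * `|K u| ^+ 2 <= e * c ^+ 2 * (opnorm K ^+ 2 * `|u| ^+ 2).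
  apply: ler_wpM2l; first by rewrite mulr_ge0 ?sqr_ge0// ltW.
  rewrite -exprMn.
  by rewrite lerXn2r ?nnegrE ?(le_trans _ (ler_opnorm _ Kcont)) ?ler_opnorm.
lra.
Qed.

(** * Proximal points and strong monotonicity *)

Local Open Scope ereal_scope.

Lemma proper_fin_num (R : realType) (H : completeNormedModType R)
    (phi : H -> \bar R) : proper_fun phi -> exists a, phi a \is a fin_num.
Proof.
move=> [phiNy [a aNy]]; exists a; rewrite fin_numE phiNy.
exact: aNy.
Qed.

(** The value at [w] is compared with the value at t v + (1 - t) w. Convexity and division by t
    leave an error t/2 |v - w|^2, which vanishes as t tends to 0. *)
Lemma prox_subgradient (R : realType) (H : completeNormedModType R)
    (dot : {dot H for idfun}) (phi : H -> \bar R) (s : R) (z w : H) :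
  induces_norm dot -> proper_fun phi -> econvex phi -> (0 < s)%R ->
  is_prox (fun v => s%:E * phi v) z w ->
  phi w \is a fin_num /\ subdifferential dot phi w (s^-1 *: (z - w)).
Proof.
move=> hdot phip cvx s0 pr.
have [a afin] := proper_fin_num phip; have [phiNy _] := phip.
have wfin : phi w \is a fin_num.
  rewrite fin_numE phiNy/=; apply/eqP => wy; have := pr a.
  by rewrite wy -(fineK afin) gt0_muley ?lte_fin// -EFinM -EFinD leye_eq.
split=> // v /=.
have [vy|vNy] := eqVneq (phi v) +oo; first by rewrite vy leey.
have vfin : phi v \is a fin_num by rewrite fin_numE phiNy.
rewrite -(fineK wfin) -(fineK vfin) -EFinD lee_fin dotZl.
set p := fine (phi w); set q := fine (phi v).
set c := dot (z - w)%R (v - w)%R; set n := (`|(v - w)%R| ^+ 2)%R.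
have key (t : R) : (0 < t <= 1)%R -> (c - t / 2 * n <= s * (q - p))%R.
  move=> /andP[t0 t1]; have t01 : (0 <= t <= 1)%R by rewrite ltW.
  have := le_trans (pr (t *: v + (1 - t) *: w)%R)
    (leeD (lee_wpmul2l (_ : 0 <= s%:E) (cvx v w t t01)) (lexx _)).
  rewrite lee_fin ltW// => /(_ isT).
  rewrite -(fineK wfin) -(fineK vfin) -/p -/q.
  rewrite !(=^~ EFinM, =^~ EFinD) lee_fin.
  have -> : (z - (t *: v + (1 - t) *: w) = (z - w) - t *: (v - w))%R.
    by rewrite scalerBr scalerBl scale1r addrCA opprD addrA.
  rewrite (sqr_normB (z - w)%R (t *: (v - w))%R hdot) dotZr -/c normrZ exprMn -/n.
  rewrite gtr0_norm// => le.
  rewrite -(ler_pM2l t0); nra.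
rewrite -(ler_pM2l s0) mulrDr mulVKf ?gt_eqF// -lerBrDr -mulrBr.
apply/ler_addgt0Pr => e e0.
have n0 : (0 <= n)%R by exact: sqr_ge0.
(* The minimum keeps t <= 1; adding 1 to [n] avoids a division by zero when v = w. *)
pose t := Num.min 1%R (e / (n + 1))%R.
have t0 : (0 < t)%R by rewrite lt_min ltr01 divr_gt0// ltr_wpDl.
have := key t; rewrite t0 ge_min lexx => /(_ isT).
suff : (t * (n + 1) <= e)%R by nra.
by rewrite -ler_pdivlMr ?ltr_wpDl// ge_min lexx orbT.
Qed.

(** Add the strong subgradient inequalities at [a] and at [b]: the function values cancel and each
    contributes half of the modulus. *)
Lemma strongly_monotone (R : realType) (H : completeNormedModType R)
    (dot : {dot H for idfun}) (phi : H -> \bar R) (mu : R) (a b u v : H) :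
  strongly_convex dot phi mu -> phi a \is a fin_num -> phi b \is a fin_num ->
  subdifferential dot phi a u -> subdifferential dot phi b v ->
  (mu * `|a - b| ^+ 2 <= dot (u - v) (a - b))%R.
Proof.
move=> [_ sc] afin bfin ua vb.
have := sc b v a vb; have := sc a u b ua.
rewrite -(fineK afin) -(fineK bfin) -!EFinD !lee_fin => + h.
rewrite -(opprB a b) normrN dotNr; move: h.
rewrite dotDl dotNl.
set n := (`|a - b| ^+ 2)%R; set c := dot u _; set d := dot v _.
lra.
Qed.

(* Polarization turns monotonicity between the proximal point and the
   minimizer into a one-step descent inequality. *)
Lemma prox_descent (R : realType) (H : completeNormedModType R)
    (dot : {dot H for idfun}) (phi : H -> \bar R) (mu s : R)
    (p q w w1 ws : H) :
  induces_norm dot -> proper_fun phi -> strongly_convex dot phi mu ->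
  (0 < s)%R -> is_prox (fun v => s%:E * phi v) (s *: p + w)%R w1 ->
  phi ws \is a fin_num -> subdifferential dot phi ws q ->
  ((s^-1 + 2 * mu) * `|w1 - ws| ^+ 2 + s^-1 * `|w1 - w| ^+ 2 <=
    s^-1 * `|w - ws| ^+ 2 + 2 * dot (p - q) (w1 - ws))%R.
Proof.
move=> hdot phip sc s0 pr wsfin qws.
have [w1fin uw1] := prox_subgradient hdot phip sc.1 s0 pr.
have := strongly_monotone sc w1fin wsfin uw1 qws.
have -> : (s^-1 *: (s *: p + w - w1) - q = (p - q) + s^-1 *: (w - w1))%R.
  by rewrite -addrA scalerDr scalerA mulVf ?gt_eqF// scale1r addrAC.
rewrite dotDl dotZl.
have := sqr_normD (w - w1)%R (w1 - ws)%R hdot.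
rewrite addrA subrK (distrC w w1).
move: (dot (p - q) (w1 - ws))%R (dot (w - w1) (w1 - ws))%R => c d.
move: (`|w1 - ws| ^+ 2)%R (`|w1 - w| ^+ 2)%R (`|w - ws| ^+ 2)%R => n1 n2 n3.
move: s^-1%R => t -> /=.
lra.
Qed.

(** * Optimality conditions at a saddle point *)

Lemma saddle_point_fin_num (R : realType) (H1 H2 : completeNormedModType R)
    (dot2 : {dot H2 for idfun}) (K : H1 -> H2)
    (g : H1 -> \bar R) (h : H2 -> \bar R) (xs : H1) (ys : H2) :
  proper_fun g -> proper_fun h ->
  is_saddle_point (saddle_fun dot2 K g h) xs ys ->
  g xs \is a fin_num /\ h ys \is a fin_num.
Proof.
move=> gp hp sp; have [gNy _] := gp; have [hNy _] := hp.
have [x0 gx0] := proper_fin_num gp; have [y0 hy0] := proper_fin_num hp.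
have := (sp x0 y0).1; have := (sp x0 y0).2; rewrite /saddle_fun.
rewrite -(fineK gx0) -(fineK hy0).
move: (gNy xs) (hNy ys); rewrite !fin_numE.
(* If [h ys] is +oo, the saddle value is -oo, even when [g xs] is +oo, which contradicts the
   comparison with [y0]. If only [g xs] is +oo, the saddle value is +oo, which contradicts the
   comparison with [x0]. *)
by case: (g xs) => [a||]; case: (h ys) => [b||].
Qed.

(** Each saddle inequality freezes one variable; cancelling the finite value of the function of that
    variable leaves a subgradient inequality. *)
Lemma saddle_point_subgradient (R : realType) (H1 H2 : completeNormedModType R)
    (dot1 : {dot H1 for idfun}) (dot2 : {dot H2 for idfun})
    (K : {linear H1 -> H2}) (Kadj : H2 -> H1)
    (g : H1 -> \bar R) (h : H2 -> \bar R) (xs : H1) (ys : H2) :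
  is_adjoint dot1 dot2 K Kadj -> proper_fun g -> proper_fun h ->
  is_saddle_point (saddle_fun dot2 K g h) xs ys ->
  subdifferential dot1 g xs (- Kadj ys)%R /\
  subdifferential dot2 h ys (K xs).
Proof.
move=> adj gp hp sp; have [gfin hfin] := saddle_point_fin_num gp hp sp.
split=> [x|y] /=.
- have := (sp x ys).2; rewrite /saddle_fun -(fineK gfin) -(fineK hfin).
  have := gp.1 x; case: (g x) => [a||]//= _; last by move=> _; exact: leey.
  rewrite !(=^~ EFinN, =^~ EFinD) !lee_fin dotNl (dotC dot1 (Kadj ys)) -adj.
  rewrite raddfB/= dotDl dotNl.
  move: (dot2 (K x) ys) (dot2 (K xs) ys) => c d.
  lra.
- have := (sp xs y).1; rewrite /saddle_fun -(fineK gfin) -(fineK hfin).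
  have := hp.1 y; case: (h y) => [a||]//= _; last by move=> _; exact: leey.
  rewrite !(=^~ EFinN, =^~ EFinD) !lee_fin dotDr dotNr.
  move: (dot2 (K xs) y) (dot2 (K xs) ys) => c d.
  lra.
Qed.

(* The Lyapunov function and its contraction *)
Local Close Scope ereal_scope.

(** This is [opnorm_young] with weight 1 / (e c^2 |K|^2), which moves the operator norm to the [v]
    term. The cases c = 0 and |K| = 0, where that weight is undefined, are direct. *)
Lemma opnorm_young_dual (R : realType) (H1 H2 : completeNormedModType R)
    (dot2 : {dot H2 for idfun}) (K : {linear H1 -> H2}) (u : H1) (v : H2)
    (e c : R) :
  induces_norm dot2 -> continuous K -> 0 < e ->
  2 * c * dot2 (K u) v <=
    e^-1 * `|u| ^+ 2 + e * c ^+ 2 * opnorm K ^+ 2 * `|v| ^+ 2.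
Proof.
move=> hdot2 Kcont e0.
have rhs0 : 0 <= e^-1 * `|u| ^+ 2 + e * c ^+ 2 * opnorm K ^+ 2 * `|v| ^+ 2.
  by apply: addr_ge0; apply: mulr_ge0;
    rewrite ?sqr_ge0 ?invr_ge0 ?(ltW e0)// -mulrA -exprMn mulr_ge0 ?sqr_ge0 ?ltW.
have [c0|c0] := eqVneq c 0; first by rewrite [in leLHS]c0 mulr0 mul0r.
have [L0|L0] := eqVneq (opnorm K) 0.
  have : `|K u| <= 0 by rewrite (le_trans (ler_opnorm _ Kcont))// L0 mul0r.
  rewrite normr_le0 => /eqP ->.
  by have := dotZl dot2 0 0 v; rewrite scale0r mul0r => ->; rewrite mulr0.
set f := e * c ^+ 2 * opnorm K ^+ 2.
have f0 : 0 < f by rewrite /f -mulrA -exprMn mulr_gt0// exprn_even_gt0//= mulf_neq0.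
have := opnorm_young u v c hdot2 Kcont (_ : 0 < f^-1).
rewrite invr_gt0 f0 invrK => /(_ isT); suff -> :
  f^-1 * c ^+ 2 * opnorm K ^+ 2 = e^-1 by [].
by rewrite /f; field; rewrite gt_eqF// L0 c0.
Qed.

(** Here [d] stands for the last increment of the x iterates and [T] for the supremum of the step
    sizes tau. *)
Definition lyapunov (R : realType) (H1 H2 : completeNormedModType R)
    (dot2 : {dot H2 for idfun}) (K : H1 -> H2) (T xi : R) (xs : H1) (ys : H2)
    (tau sigma : R) (x d : H1) (y : H2) : R :=
  tau^-1 * `|x - xs| ^+ 2 + sigma^-1 * `|y - ys| ^+ 2
  + xi * (2 * dot2 (K d) (y - ys) + T^-1 * `|d| ^+ 2).

(** The increment term pays for the coupling: Young's inequality with weight [eta] costs |d|^2 /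
    eta, which is at most |d|^2 / T. *)
Lemma lyapunov_ge (R : realType) (H1 H2 : completeNormedModType R)
    (dot2 : {dot H2 for idfun}) (K : {linear H1 -> H2}) (T S xi eta : R)
    (xs : H1) (ys : H2) (tau sigma : R) (x d : H1) (y : H2) :
  induces_norm dot2 -> continuous K -> 0 < tau -> tau <= T -> T <= eta ->
  0 < sigma -> sigma <= S -> 0 <= xi ->
  T^-1 * `|x - xs| ^+ 2
  + (S^-1 - xi * eta * opnorm K ^+ 2) * `|y - ys| ^+ 2
  <= lyapunov dot2 K T xi xs ys tau sigma x d y.
Proof.
move=> hdot2 Kcont tau0 tauT Teta sigma0 sigmaS xi0; rewrite /lyapunov.
have T0 : 0 < T := lt_le_trans tau0 tauT.
have S0 : 0 < S := lt_le_trans sigma0 sigmaS.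
have eta0 : 0 < eta := lt_le_trans T0 Teta.
(* The coefficient -1 turns the upper bound into a lower bound on the coupling. *)
have := opnorm_young_dual d (y - ys) (-1) hdot2 Kcont eta0.
have : T^-1 <= tau^-1 by rewrite lef_pV2.
have : S^-1 <= sigma^-1 by rewrite lef_pV2.
have : eta^-1 <= T^-1 by rewrite lef_pV2.
have := sqr_ge0 `|d|; have := sqr_ge0 `|x - xs|; have := sqr_ge0 `|y - ys|.
rewrite sqrrN expr1n mulr1.
move: (`|d| ^+ 2) (`|x - xs| ^+ 2) (`|y - ys| ^+ 2) (opnorm K ^+ 2) => D X Y L.
move: (dot2 (K d) (y - ys)) tau^-1 T^-1 eta^-1 sigma^-1 S^-1.
move=> c t T' e s S' Y0 X0 D0 eT Ss Tt yg.
have h1 := ler_wpM2r X0 Tt; have h2 := ler_wpM2r Y0 Ss.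
have h3 := ler_wpM2r D0 eT.
have : 0 <= xi * (2 * c + T' * D + eta * L * Y) by rewrite mulr_ge0//; lra.
lra.
Qed.

(** In the sum of the two descent inequalities the products of [K (x1 - xs)] with [y1 - ys] cancel,
    and that of [K (x1 - x)] with [y1 - ys] becomes the new coupling. Writing a = xi + (a - xi)
    isolates the old coupling. *)
Lemma lyapunov_step (R : realType) (H1 H2 : completeNormedModType R)
    (dot1 : {dot H1 for idfun}) (dot2 : {dot H2 for idfun})
    (K : {linear H1 -> H2}) (Kadj : H2 -> H1)
    (T xi mu nu e1 e2 e3 a b tau sigma tau1 sigma1 : R)
    (x d x1 xs : H1) (y y1 ys : H2) :
  induces_norm dot2 -> continuous K -> is_adjoint dot1 dot2 K Kadj ->
  0 < xi -> 0 < e1 -> 0 < e2 -> 0 < e3 ->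
  (tau^-1 + 2 * mu) * `|x1 - xs| ^+ 2 + tau^-1 * `|x1 - x| ^+ 2 <=
    tau^-1 * `|x - xs| ^+ 2
    + 2 * dot1 (- Kadj (y1 + b *: (y1 - y)) - - Kadj ys) (x1 - xs) ->
  (sigma^-1 + 2 * nu) * `|y1 - ys| ^+ 2 + sigma^-1 * `|y1 - y| ^+ 2 <=
    sigma^-1 * `|y - ys| ^+ 2
    + 2 * dot2 (K (x + a *: d) - K xs) (y1 - ys) ->
  e1 * opnorm K ^+ 2 * xi + (e2 * xi)^-1 <= T^-1 -> e1^-1 + e3^-1 <= sigma^-1 ->
  T^-1 <= tau^-1 ->
  xi^-1 * tau1^-1 <= tau^-1 + 2 * mu - e3 * opnorm K ^+ 2 * b ^+ 2 ->
  xi^-1 * sigma1^-1 <= sigma^-1 + 2 * nu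
                       - e2 * opnorm K ^+ 2 * (xi - a) ^+ 2 ->
  lyapunov dot2 K T xi xs ys tau1 sigma1 x1 (x1 - x) y1 <=
    xi * lyapunov dot2 K T xi xs ys tau sigma x d y.
Proof.
move=> hdot2 Kcont adj xi0 e10 e20 e30 hx hy hT hS hTtau ht hs.
(* These three bounds cover the remaining cross terms, with coefficients -b, xi and a - xi. *)
have Y1 := opnorm_young (x1 - xs) (y1 - y) (- b) hdot2 Kcont e30.
have Y2 := opnorm_young d (y1 - y) xi hdot2 Kcont e10.
have Y3 := opnorm_young_dual d (y1 - ys) (a - xi) hdot2 Kcont e20.
have crossx : dot1 (- Kadj (y1 + b *: (y1 - y)) - - Kadj ys) (x1 - xs) =
    - dot2 (K (x1 - xs)) (y1 - ys) - b * dot2 (K (x1 - xs)) (y1 - y).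
  rewrite dotC !(dotDr, dotNr) opprK -!adj.
  by rewrite !(dotDr, dotNr, dotZr); ring.
(* The splitting x - xs = (x1 - xs) - (x1 - x) produces the term that cancels against [crossx]. *)
have crossy : dot2 (K (x + a *: d) - K xs) (y1 - ys) =
    dot2 (K (x1 - xs)) (y1 - ys) - dot2 (K (x1 - x)) (y1 - ys)
    + a * (dot2 (K d) (y - ys) + dot2 (K d) (y1 - y)).
  have KB u v : K (u - v) = K u - K v by exact: linearB.
  have -> : K (x + a *: d) = K x + a *: K d by rewrite linearD linearZ.
  by rewrite !KB !(dotDl, dotNl, dotZl) !(dotDr, dotNr); ring.
have dyE : dot2 (K d) (y1 - ys) = dot2 (K d) (y - ys) + dot2 (K d) (y1 - y).
  by rewrite !(dotDr, dotNr); ring.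
move: hx hy Y1 Y2 Y3; rewrite crossx crossy dyE /lyapunov.
(* The left side is the total cost in |d|^2 of [Y2] and [Y3]; the right side is what the old
   Lyapunov value provides after division by xi. *)
have hT' : e1 * xi ^+ 2 * opnorm K ^+ 2 + e2^-1 <= xi * T^-1.
  suff -> : e1 * xi ^+ 2 * opnorm K ^+ 2 + e2^-1 =
      xi * (e1 * opnorm K ^+ 2 * xi + (e2 * xi)^-1) by rewrite ler_pM2l.
  by field; rewrite !gt_eqF.
have := sqr_ge0 `|d|; have := sqr_ge0 `|x1 - xs|.
have := sqr_ge0 `|y1 - ys|; have := sqr_ge0 `|y1 - y|.
have := sqr_ge0 `|x1 - x|.
move: (`|d| ^+ 2) (`|x1 - xs| ^+ 2) (`|y1 - ys| ^+ 2) (`|y1 - y| ^+ 2)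
  (`|x1 - x| ^+ 2) (`|x - xs| ^+ 2) (`|y - ys| ^+ 2)
  => D X1 Y1 V U X Y U0 V0 Y10 X10 D0.
move: (dot2 (K d) (y - ys)) (dot2 (K d) (y1 - y)) (dot2 (K (x1 - xs)) (y1 - y))
  (dot2 (K (x1 - xs)) (y1 - ys)) (dot2 (K (x1 - x)) (y1 - ys)) => c1 c2 c3 c4 c5.
have -> : (- b) ^+ 2 = b ^+ 2 by rewrite sqrrN.
have -> : (a - xi) ^+ 2 = (xi - a) ^+ 2 by rewrite -sqrrN opprB.
move: hT' hS hTtau ht hs; move: (opnorm K ^+ 2) tau1^-1 sigma1^-1 T^-1.
move=> L t1 s1 T'.
move=> hT' hS hTtau ht hs hx hy y1' y2 y3.
have m1 := ler_wpM2r D0 hT'.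
have m2 := ler_wpM2r V0 hS.
have m3 := ler_wpM2r U0 hTtau.
have m4 := ler_wpM2r X10 ht.
have m5 := ler_wpM2r Y10 hs.
(* With xi factored out, the goal is a linear combination of the descent inequalities, the Young
   bounds and [m1] to [m5]. *)
have -> : t1 * X1 + s1 * Y1 + xi * (2 * c5 + T' * U) =
  xi * (xi^-1 * t1 * X1 + xi^-1 * s1 * Y1 + (2 * c5 + T' * U)).
  by field; rewrite gt_eqF.
rewrite ler_pM2l//.
move: m1 m2 m3 m4 m5 hx hy y1' y2 y3.
lra.
Qed.

(** * Geometric decay and bounds on the step sizes *)

Lemma geometric_sqr_cvg (R : realType) (V : normedModType R) (u : nat -> V)
    (l : V) (C q : R) : 0 <= q < 1 ->
  (forall k, `|u k - l| ^+ 2 <= C * q ^+ k) -> u @ \oo --> l.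
Proof.
move=> /andP[q0 q1] bnd; apply/cvgrPdist_lt => e e0.
have geo : geometric C q @ \oo --> 0 by apply: cvg_geometric; rewrite ger0_norm.
have e20 : 0 < e ^+ 2 by rewrite exprn_gt0.
near=> k; rewrite distrC -(ltr_pXn2r (n := 2)) ?nnegrE ?(ltW e0)//.
apply: (le_lt_trans (bnd k)); apply: le_lt_trans (ler_norm _) _.
by near: k; exact: (cvgr0_norm_lt (geometric C q : nat -> R^o)).
Unshelve. all: by end_near. Qed.

Local Open Scope ereal_scope.

Lemma seq_sup_ge (R : realType) (u : nat -> R) k : (u k)%:E <= seq_sup u.
Proof. by apply: ereal_sup_ubound; exists k. Qed.

Lemma seq_inf_le (R : realType) (u : nat -> R) k : seq_inf u <= (u k)%:E.
Proof. by apply: ereal_inf_lbound; exists k. Qed.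

Lemma seq_sup_fin_num (R : realType) (u : nat -> R) :
  seq_sup u != +oo -> seq_sup u \is a fin_num.
Proof.
move=> uy; rewrite fin_numE uy andbT.
by rewrite gt_eqF// (lt_le_trans _ (seq_sup_ge u 0))// ltNyr.
Qed.

Lemma le_fine_seq_sup (R : realType) (u : nat -> R) k :
  seq_sup u != +oo -> (u k <= fine (seq_sup u))%R.
Proof.
by move=> uy; rewrite -lee_fin fineK ?seq_sup_ge// seq_sup_fin_num.
Qed.

(** All step sizes lie between the infimum and the supremum, so the three indices are independent.
    This lets consecutive step sizes differ in the contraction; [m] is 2 mu or 2 nu there. *)
Lemma step_size_bound (R : realType) (t w : nat -> R) (xi c m : R) :
  (forall k, 0 < t k)%R -> 0 < seq_inf t -> seq_sup t != +oo ->
  (0 < xi)%R -> (0 <= c)%R ->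
  (xi%:E * seq_inf t)^-1 - (seq_sup t)^-1 + c%:E * seq_sup w <= m%:E ->
  forall j k l, (xi^-1 * (t j)^-1 <= (t k)^-1 + m - c * w l)%R.
Proof.
move=> t0 inf0 supy xi0 c0 + j k l.
have infin : seq_inf t \is a fin_num.
  rewrite fin_numE (gt_eqF (lt_trans (ltNyr 0) inf0))//=.
  by rewrite lt_eqF// (le_lt_trans (seq_inf_le t 0))// ltry.
have tj := seq_inf_le t j; have tk := le_fine_seq_sup k supy.
move: inf0 tj; rewrite -(fineK infin) -(fineK (seq_sup_fin_num supy)).
move: (fine (seq_inf t)) (fine (seq_sup t)) tk => i T tk.
rewrite lte_fin lee_fin => i0 ij.
have T0 : (0 < T)%R := lt_le_trans (t0 k) tk.
have tT : (T^-1 <= (t k)^-1)%R by rewrite lef_pV2// posrE.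
have tI : ((t j)^-1 <= i^-1)%R by rewrite lef_pV2// posrE.
have xI : (xi^-1 * (t j)^-1 <= xi^-1 * i^-1)%R.
  by rewrite ler_pM2l ?invr_gt0.
(* The supremum of [w] is not known to be finite, so this comparison stays in the extended reals. *)
have cw : (c * w l)%:E <= c%:E * seq_sup w.
  by rewrite EFinM lee_wpmul2l ?lee_fin// seq_sup_ge.
rewrite -EFinM !inver !gt_eqF ?mulr_gt0// -EFinB => h.
have := le_trans (leeD2l (((xi * i)^-1 - T^-1)%:E) cw) h.
rewrite -EFinD lee_fin invfM; lra.
Qed.

(** * Linear convergence of the iterates *)

Theorem theorem3p2 (R : realType) (H1 H2 : completeNormedModType R)
    (dot1 : {dot H1 for idfun}) (dot2 : {dot H2 for idfun})
    (hdot1 : induces_norm dot1) (hdot2 : induces_norm dot2)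
    (K : {linear H1 -> H2}) (Kcont : continuous K)
    (Kadj : H2 -> H1) (hKadj : is_adjoint dot1 dot2 K Kadj)
    (g : H1 -> \bar R) (h : H2 -> \bar R)
    (gproper : proper_fun g) (hproper : proper_fun h)
    (glsc : lower_semicontinuous g) (hlsc : lower_semicontinuous h)
    (mu nu : R) (mu_gt0 : (0 < mu)%R) (nu_gt0 : (0 < nu)%R)
    (gconvex : strongly_convex dot1 g mu) (hconvex : strongly_convex dot2 h nu)
    (xs : H1) (ys : H2)
    (saddle : is_saddle_point (saddle_fun dot2 K g h) xs ys)
    (tau sigma alpha beta : nat -> R)
    (tau_gt0 : forall k, (0 < tau k)%R) (sigma_gt0 : forall k, (0 < sigma k)%R)
    (alpha_ge0 : forall k, (0 <= alpha k)%R)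
    (beta_ge0 : forall k, (0 <= beta k)%R)
    (x xbar : nat -> H1) (y ybar : nat -> H2)
    (iter : alternating_prox_mapping K Kadj g h tau sigma alpha beta
              x xbar y ybar)
    (inf_tau : 0 < seq_inf tau) (inf_sigma : 0 < seq_inf sigma)
    (xi : R) (xi_gt0 : (0 < xi)%R) (xi_lt1 : (xi < 1)%R)
    (hxi : xi%:E * seq_sup tau * seq_sup sigma * (opnorm K ^+ 2)%:E < 1)
    (eta1 eta2 eta3 eta4 : R)
    (eta1_gt0 : (0 < eta1)%R) (eta2_gt0 : (0 < eta2)%R)
    (eta3_gt0 : (0 < eta3)%R) (eta4_gt0 : (0 < eta4)%R)
    (heta12 : (eta1 * opnorm K ^+ 2 * xi + (eta2 * xi)^-1)%:E
              <= (seq_sup tau)^-1)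
    (heta13 : (eta1^-1 + eta3^-1)%:E <= (seq_sup sigma)^-1)
    (heta4 : seq_sup tau <= eta4%:E)
    (heta4' : (eta4 * xi * opnorm K ^+ 2)%:E < (seq_sup sigma)^-1)
    (hmu : (xi%:E * seq_inf tau)^-1 - (seq_sup tau)^-1
           + (eta3 * opnorm K ^+ 2)%:E * seq_sup (fun k => beta k ^+ 2)%R
           <= (2 * mu)%:E)
    (hnu : (xi%:E * seq_inf sigma)^-1 - (seq_sup sigma)^-1
           + (eta2 * opnorm K ^+ 2)%:E
             * seq_sup (fun k => (xi - alpha k) ^+ 2)%R
           <= (2 * nu)%:E) :
  (forall k : nat,
     (`|x k.+1 - xs| ^+ 2)%:E <=
       (xi ^+ k.+1)%:E * seq_sup tau
       * ((tau 0%N)^-1 * `|xs - x 0%N| ^+ 2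
          + (sigma 0%N)^-1 * `|ys - y 0%N| ^+ 2)%:E /\
     (`|y k.+1 - ys| ^+ 2)%:E <=
       (xi ^+ k.+1)%:E
       * ((seq_sup sigma)^-1 - (xi * eta4 * opnorm K ^+ 2)%:E)^-1
       * ((tau 0%N)^-1 * `|xs - x 0%N| ^+ 2
          + (sigma 0%N)^-1 * `|ys - y 0%N| ^+ 2)%:E) /\
  converges_linearly x y xs ys xi.
Proof.
have supT : seq_sup tau != +oo by rewrite lt_eqF// (le_lt_trans heta4)// ltry.
(* An infinite supremum would have inverse 0, below the positive number 1/eta1 + 1/eta3. *)
have supS : seq_sup sigma != +oo.
  apply/eqP => Sy; move: heta13; rewrite Sy invey lee_fin leNgt.
  by rewrite addr_gt0 ?invr_gt0.
set L2 := (opnorm K ^+ 2)%R in heta12 heta4' hmu hnu *.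
have L20 : (0 <= L2)%R by exact: sqr_ge0.
have htau := step_size_bound tau_gt0 inf_tau supT xi_gt0
  (mulr_ge0 (ltW eta3_gt0) L20) hmu.
have hsigma := step_size_bound sigma_gt0 inf_sigma supS xi_gt0
  (mulr_ge0 (ltW eta2_gt0) L20) hnu.
have tauT k := le_fine_seq_sup k supT.
have sigmaS k := le_fine_seq_sup k supS.
move: heta12 heta13 heta4 heta4'.
rewrite -(fineK (seq_sup_fin_num supT)) -(fineK (seq_sup_fin_num supS)).
move: (fine (seq_sup tau)) (fine (seq_sup sigma)) tauT sigmaS.
move=> T S tauT sigmaS.
have T0 : (0 < T)%R := lt_le_trans (tau_gt0 0%N) (tauT 0%N).
have S0 : (0 < S)%R := lt_le_trans (sigma_gt0 0%N) (sigmaS 0%N).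
rewrite !inver !gt_eqF// !lee_fin lte_fin => hT hS Teta cpos.
have [gfin hfin] := saddle_point_fin_num gproper hproper saddle.
have [gsub hsub] := saddle_point_subgradient hKadj gproper hproper saddle.
have [xbar0 _ step] := iter.
have xbarE k : (xbar k = x k + alpha k.-1 *: (x k - x k.-1))%R.
  (* The step at k = 0 may use alpha_0 for alpha_{-1}, since x_0 - x_{-1} = 0. *)
  case: k => [|k]; last by have [] := step k.
  by rewrite subrr scaler0 addr0.
(* Since [0.-1] is 0, the increment at index 0 vanishes, in accordance with x_{-1} = x_0; hence
   [E 0] reduces to the weighted initial distances. *)
pose E k := lyapunov dot2 K T xi xs ys (tau k) (sigma k)
  (x k) (x k - x k.-1)%R (y k).
have E_step k : (E k.+1 <= xi * E k)%R.
  have [py ybarE px _] := step k.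
  rewrite -scalerN in px.
  have dx := prox_descent hdot1 gproper gconvex (tau_gt0 k) px gfin gsub.
  have dy := prox_descent hdot2 hproper hconvex (sigma_gt0 k) py hfin hsub.
  rewrite ybarE in dx; rewrite xbarE in dy.
  apply: (lyapunov_step hdot2 Kcont hKadj xi_gt0 eta1_gt0 eta2_gt0 eta3_gt0
    dx dy) => //.
  - by rewrite (le_trans hS)// lef_pV2 ?posrE.
  - by rewrite lef_pV2 ?posrE.
set E0 := ((tau 0%N)^-1 * `|xs - x 0%N| ^+ 2
  + (sigma 0%N)^-1 * `|ys - y 0%N| ^+ 2)%R.
have E0E : E 0%N = E0.
  rewrite /E /lyapunov subrr linear0 normr0 (distrC (x _)) (distrC (y _)).
  have -> : dot2 0%R (y 0%N - ys)%R = 0%R.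
    by have := dotZl dot2 0 0%R (y 0%N - ys)%R; rewrite scaler0 mul0r.
  by rewrite expr0n !mulr0 addr0 mulr0 addr0.
have E_le k : (E k <= xi ^+ k * E0)%R.
  elim: k => [|k IHk]; first by rewrite mul1r E0E.
  by rewrite (le_trans (E_step k))// exprS -mulrA ler_pM2l.
set c := (S^-1 - xi * eta4 * L2)%R.
have c0 : (0 < c)%R by rewrite subr_gt0 (mulrC xi).
(* Both terms on the left are nonnegative. Dropping one and dividing by the coefficient of the other
   gives the factors [T] and [c^-1] in the two bounds. *)
have main k : (T^-1 * `|x k - xs| ^+ 2 + c * `|y k - ys| ^+ 2 <=
    xi ^+ k * E0)%R.
  apply: le_trans (E_le k).
  by apply: lyapunov_ge => //; exact: ltW.
have x_le k : (`|x k - xs| ^+ 2 <= xi ^+ k * T * E0)%R.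
  rewrite mulrAC -ler_pdivrMr// mulrC (le_trans _ (main k))// lerDl.
  by rewrite mulr_ge0 ?sqr_ge0// ltW.
have y_le k : (`|y k - ys| ^+ 2 <= xi ^+ k * c^-1 * E0)%R.
  rewrite mulrAC ler_pdivlMr// mulrC (le_trans _ (main k))// lerDr.
  by rewrite mulr_ge0 ?sqr_ge0// invr_ge0 ltW.
split=> [k|].
  by rewrite -EFinB inver gt_eqF// -!EFinM !lee_fin.
have xi01 : (0 <= xi < 1)%R by rewrite ltW.
split.
- apply: (geometric_sqr_cvg (C := (T * E0)%R) xi01) => k.
  by rewrite (le_trans (x_le k))// -mulrA mulrC.
- apply: (geometric_sqr_cvg (C := (c^-1 * E0)%R) xi01) => k.
  by rewrite (le_trans (y_le k))// -mulrA mulrC.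
- exists (T * E0 + c^-1 * E0)%R => k.
  by have := x_le k; have := y_le k; lra.
Qed.
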